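(* Let $\mathbf{k}$ be a commutative ring, let $k\le n$ be positive integers and let $I,K\subseteq[n-1]$ with $I\subseteq K$. Then the coefficient of $\mathbf{B}_K$ in the expansion of $\mathbf{D}_{[k-1]}\mathbf{B}_I$ in the basis $(\mathbf{B}_J)_{J\subseteq[n-1]}$ of $\Sigma_n$ is \[ [\mathbf{B}_K]\,\mathbf{D}_{[k-1]}\mathbf{B}_I=(-1)^{k+|K|}\sum_{\substack{U\subseteq \overline{K|I};\\ \Sigma U>n-k}}(-1)^{|U|}, \] where the sum runs over all $2^{|I|+1}$ subsequences $U$ of the sequence $\overline{K|I}$ (subsequences are distinguished by the positions chosen, regardless of repeated entries), $|U|$ denotes the length of $U$ and $\Sigma U$ the sum of its entries.
   Context: $[m]=\{1,\dots,m\}$; $S_n$ is the symmetric group on $[n]$, and products in $\mathbf{k}S_n$ are given by composition, $(\pi\sigma)(i)=\pi(\sigma(i))$. $\operatorname{Des}(\pi)=\{i\in[n-1]:\pi(i)>\pi(i+1)\}$. For $I\subseteq[n-1]$: $\mathbf{D}_I=\sum_{\operatorname{Des}(\pi)=I}\pi$ and $\mathbf{B}_I=\sum_{\operatorname{Des}(\pi)\subseteq I}\pi$. The descent algebra $\Sigma_n$ is the span of the $\mathbf{D}_I$; both $(\mathbf{D}_I)$ and $(\mathbf{B}_I)$ are bases of it, and $[\mathbf{B}_K]f$ denotes the coefficient of $\mathbf{B}_K$ in $f\in\Sigma_n$. A composition of $n$ is a finite sequence of positive integers summing to $n$. For $I=\{i_1<\dots<i_p\}\subseteq[n-1]$, $\operatorname{comp}(I)=(i_1,i_2-i_1,\dots,i_p-i_{p-1},n-i_p)$.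 If $I\subseteq K$, then $\operatorname{comp}(K)=(\alpha_1,\dots,\alpha_m)$ refines $\operatorname{comp}(I)=(\beta_1,\dots,\beta_p)$, i.e. $\operatorname{comp}(K)$ splits uniquely into consecutive blocks $\alpha^1,\dots,\alpha^p$ with the entries of $\alpha^i$ summing to $\beta_i$; $\overline{K|I}$ is the sequence $(\text{last entry of }\alpha^1,\dots,\text{last entry of }\alpha^p)$, of length $|I|+1$. *)

(* Defs.v *)
From HB Require Import structures.
From mathcomp Require Import all_boot all_order all_algebra all_fingroup.
From mathcomp Require Import zify.

Set Implicit Arguments.
Unset Strict Implicit.
Unset Printing Implicit Defensive.

Import GRing.Theory.
Local Open Scope ring_scope.

(* The group algebra of S_n over R is the R-module {ffun 'S_n -> R^o}. The
   canonical pointwise product of {ffun 'S_n -> R^o} is not the product of the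
   group algebra; the latter is galg_mul below. Permutations act on
   'I_n = {0, ..., n-1}. *)
Notation galg R n := {ffun 'S_n -> R^o}.

(* MathComp's product of permutations is (s * t)%g x = t (s x). *)
Definition pcomp (n : nat) (p s : 'S_n) : 'S_n := (s * p)%g.

Lemma pcompE (n : nat) (p s : 'S_n) (i : 'I_n) : pcomp p s i = p (s i).
Proof. by rewrite /pcomp permM. Qed.

Definition galg_of (R : comPzRingType) (n : nat) (p : 'S_n) : galg R n :=
  [ffun t => (t == p)%:R].

Definition galg_mul (R : comPzRingType) (n : nat) (f g : galg R n) : galg R n :=
  [ffun t => \sum_(p : 'S_n) \sum_(s : 'S_n | pcomp p s == t) f p * g s].

Lemma galg_mul_of (R : comPzRingType) (n : nat) (p s : 'S_n) :
  galg_mul (galg_of R p) (galg_of R s) = galg_of R (pcomp p s).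
Proof.
apply/ffunP=> t; rewrite !ffunE (bigD1 p) //= [X in _ + X]big1 ?addr0; last first.
  by move=> q nq; apply: big1 => s' _; rewrite !ffunE (negPf nq) mul0r.
under eq_bigr => s' _ do rewrite !ffunE eqxx mul1r.
rewrite [t == _]eq_sym; case: eqP => [e|ne].
  by rewrite (bigD1 s) ?e ?eqxx //= big1 ?eqxx ?addr0 // => s' /andP[_ /negPf->].
by apply: big1 => s' /eqP e'; case: eqP => // es; case: ne; rewrite -e' es.
Qed.

(* A subset of [n-1] is a {set 'I_n.-1}, with i : 'I_n.-1 standing for the
   element i.+1 of [n-1]; accordingly its positions i.+1 and i.+2 in [n] are
   the elements i and i.+1 of 'I_n. *)
Lemma ord_nxt_subproof (n : nat) (i : 'I_n.-1) : (i.+1 < n)%N.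
Proof. by have := ltn_ord i; lia. Qed.

Definition ord_cur (n : nat) (i : 'I_n.-1) : 'I_n := widen_ord (leq_pred n) i.
Definition ord_nxt (n : nat) (i : 'I_n.-1) : 'I_n :=
  Ordinal (ord_nxt_subproof i).

Definition Des (n : nat) (p : 'S_n) : {set 'I_n.-1} :=
  [set i | (p (ord_nxt i) < p (ord_cur i))%N].

Definition Dsum (R : comPzRingType) (n : nat) (I : {set 'I_n.-1}) : galg R n :=
  \sum_(p : 'S_n | Des p == I) galg_of R p.

Definition Bsum (R : comPzRingType) (n : nat) (I : {set 'I_n.-1}) : galg R n :=
  \sum_(p : 'S_n | Des p \subset I) galg_of R p.

(* The subset {1, ..., m} of [n-1]. *)
Definition initset (n m : nat) : {set 'I_n.-1} :=
  [set i : 'I_n.-1 | (i.+1 <= m)%N].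

Definition in_descent_algebra (R : comPzRingType) (n : nat) (f : galg R n) :
    Prop :=
  exists c : {ffun {set 'I_n.-1} -> R}, f = \sum_J c J *: Dsum R J.

Lemma DsumE (R : comPzRingType) (n : nat) (I : {set 'I_n.-1}) (p : 'S_n) :
  Dsum R I p = (Des p == I)%:R.
Proof.
rewrite /Dsum sum_ffunE; case: eqP => [e|ne].
  rewrite (bigD1 p) ?e ?eqxx //= ffunE eqxx big1 ?addr0 // => q /andP[_ nq].
  by rewrite ffunE eq_sym (negPf nq).
apply: big1 => q /eqP e; rewrite ffunE; case: eqP => // epq.
by case: ne; rewrite epq.
Qed.

Lemma BsumE (R : comPzRingType) (n : nat) (I : {set 'I_n.-1}) :
  Bsum R I = \sum_(J : {set 'I_n.-1} | J \subset I) Dsum R J.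
Proof.
rewrite /Bsum (partition_big (@Des n) (fun J => J \subset I)) //=.
apply: eq_bigr => J sJI; apply: eq_bigl => p.
by case: eqP => [->|_]; rewrite ?sJI ?andbF.
Qed.

Lemma Bsum_descent (R : comPzRingType) (n : nat) (I : {set 'I_n.-1}) :
  in_descent_algebra (Bsum R I).
Proof.
exists [ffun J : {set 'I_n.-1} => (J \subset I)%:R]; rewrite BsumE big_mkcond.
by apply: eq_bigr => J _; rewrite ffunE; case: ifP; rewrite ?scale1r ?scale0r.
Qed.

Lemma Dsum_Bspan (R : comPzRingType) (n : nat) (I : {set 'I_n.-1}) :
  exists c : {ffun {set 'I_n.-1} -> R}, Dsum R I = \sum_J c J *: Bsum R J.
Proof.
have [m] := ubnP #|I|; elim: m I => // m IHm I ltIm.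
have /fin_all_exists [c Hc] (J : {set 'I_n.-1}) :
    exists cJ : {ffun {set 'I_n.-1} -> R},
      J \proper I -> Dsum R J = \sum_L cJ L *: Bsum R L.
  case: (boolP (J \proper I)) => [pJ|_]; last by exists [ffun=> 0].
  have [|cJ HcJ] := IHm J; last by exists cJ.
  by rewrite -ltnS; apply: leq_trans ltIm; rewrite ltnS proper_card.
exists [ffun L => (L == I)%:R - \sum_(J : {set 'I_n.-1} | J \proper I) c J L].
have -> : Dsum R I =
    Bsum R I - \sum_(J : {set 'I_n.-1} | J \proper I) Dsum R J.
  rewrite BsumE (bigD1 I) //= addrC; apply/esym/eqP; rewrite subr_eq addrC.
  apply/eqP; congr (_ + _); apply: eq_bigl => J.
  by rewrite properEneq andbC.
under [RHS]eq_bigr => L _ do rewrite ffunE scalerBl scaler_suml.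
rewrite sumrB exchange_big /=; congr (_ - _).
  rewrite (bigD1 I) //= eqxx scale1r big1 ?addr0 // => L /negPf->.
  by rewrite scale0r.
by apply: eq_bigr => J /Hc.
Qed.

Lemma descent_Bspan (R : comPzRingType) (n : nat) (f : galg R n) :
  in_descent_algebra f ->
  exists c : {ffun {set 'I_n.-1} -> R}, f == \sum_J c J *: Bsum R J.
Proof.
case=> d ->; have /fin_all_exists [c Hc] := @Dsum_Bspan R n.
exists [ffun L => \sum_J d J * c J L]; apply/eqP.
under [RHS]eq_bigr => L _ do rewrite ffunE scaler_suml.
rewrite exchange_big; apply: eq_bigr => J _; rewrite [in LHS]Hc scaler_sumr.
by apply: eq_bigr => L _; rewrite scalerA.
Qed.

(* The coefficient of Bsum K in f; it is well defined by Bcoef_eq. *)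
Definition Bcoef (R : comPzRingType) (n : nat) (f : galg R n)
    (hf : in_descent_algebra f) (K : {set 'I_n.-1}) : R :=
  xchoose (descent_Bspan hf) K.

Lemma BcoefE (R : comPzRingType) (n : nat) (f : galg R n)
    (hf : in_descent_algebra f) : f = \sum_J Bcoef hf J *: Bsum R J.
Proof. exact/eqP/(xchooseP (descent_Bspan hf)). Qed.

Lemma Des_surj (n : nat) (I : {set 'I_n.-1}) : exists p : 'S_n, Des p = I.
Proof.
pose asc i := #|[set j : 'I_n.-1 | (j < i)%N && (j \notin I)]|.
pose key (i : 'I_n) := (asc i * n + (n.-1 - i))%N.
have key_inj : injective key.
  move=> i j; rewrite /key => e; apply/val_inj => /=.
  have {}e : ((n.-1 - i) %% n = (n.-1 - j) %% n)%N.
    by rewrite -(modnMDl (asc i)) e modnMDl.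
  have [li lj] := (ltn_ord i, ltn_ord j).
  by move: e; rewrite !modn_small; lia.
pose rk (i : 'I_n) := #|[set j | (key j < key i)%N]|.
have rk_lt i : (rk i < n)%N.
  rewrite -[X in (_ < X)%N]card_ord -cardsT; apply: proper_card.
  by rewrite properT; apply/eqP=> /setP/(_ i); rewrite !inE ltnn.
have rk_mono i j : (rk i < rk j)%N = (key i < key j)%N.
  case: (ltnP (key i) (key j)) => [lt_ij|le_ji].
    apply: proper_card; apply/properP; split.
      by apply/subsetP=> l; rewrite !inE => /ltn_trans->.
    by exists i; rewrite !inE ?ltnn.
  apply/negbTE; rewrite -leqNgt; apply: subset_leq_card.
  by apply/subsetP=> l; rewrite !inE => /leq_trans->.
have p_inj : injective (fun i => Ordinal (rk_lt i)).
  move=> i j /(congr1 val) /= e; apply: key_inj.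
  have := rk_mono i j; have := rk_mono j i; rewrite e ltnn.
  by case: (ltngtP (key i) (key j)).
exists (perm p_inj); apply/setP=> i; rewrite inE !permE /= rk_mono /key /=.
have li := ltn_ord i.
have -> : asc i.+1 = ((i \notin I) + asc i)%N.
  rewrite /asc (cardsD1 i) inE leqnn /=; congr (_ + _)%N.
  apply: eq_card => j; rewrite !inE ltnS leq_eqVlt -val_eqE.
  by case: ltngtP.
by case: (i \in I) => /=; rewrite ?mulnDl; lia.
Qed.

Lemma Bsum_free (R : comPzRingType) (n : nat) (c : {set 'I_n.-1} -> R) :
  \sum_J c J *: Bsum R J = 0 -> forall J, c J = 0.
Proof.
move=> c0 J; have [m] := ubnP #|~: J|; elim: m J => // m IHm J ltJm.
have [p DpJ] := Des_surj J.
have := congr1 (fun f : galg R n => f p) c0.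
rewrite sum_ffunE ffunE (bigD1 J) //= big1 ?addr0 => [|L nLJ]; rewrite !ffunE BsumE.
  rewrite sum_ffunE (bigD1 J) //= DsumE DpJ eqxx big1 ?addr0 => [|L /andP[_ nL]].
    by rewrite [_ *: _]mulr1.
  by rewrite DsumE DpJ eq_sym (negPf nL).
rewrite sum_ffunE.
have [sJL|nsJL] := boolP (J \subset L).
  rewrite (IHm L) ?[_ *: _]mul0r // -ltnS; apply: leq_trans ltJm; rewrite ltnS.
  by apply: proper_card; rewrite properC properEneq eq_sym nLJ.
rewrite big1 ?[_ *: _]mulr0 // => M sML; rewrite DsumE DpJ; case: eqP => // eJM.
by rewrite eJM sML in nsJL.
Qed.

Lemma Bcoef_eq (R : comPzRingType) (n : nat) (f : galg R n)
    (hf : in_descent_algebra f) (c : {set 'I_n.-1} -> R) :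
  f = \sum_J c J *: Bsum R J -> forall K, Bcoef hf K = c K.
Proof.
move=> fc K; apply/eqP; rewrite -subr_eq0; apply/eqP.
apply: (@Bsum_free R n (fun J => Bcoef hf J - c J)).
under eq_bigr do rewrite scalerBl.
by rewrite sumrB -fc -BcoefE subrr.
Qed.

Definition elts (n : nat) (I : {set 'I_n.-1}) : seq nat :=
  [seq i.+1 | i : 'I_n.-1 <- enum I].

(* comp(I), a composition of n when n > 0; enum I is increasing. *)
Definition set_comp (n : nat) (I : {set 'I_n.-1}) : seq nat :=
  pairmap (fun a b => b - a)%N 0%N (rcons (elts I) n).

(* The length of the shortest prefix of alpha with sum b. *)
Definition block_size (alpha : seq nat) (b : nat) : nat :=
  find (fun j => sumn (take j alpha) == b) (iota 0 (size alpha).+1).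

(* The consecutive blocks of alpha whose sums are the entries of beta. *)
Fixpoint blocks (alpha beta : seq nat) : seq (seq nat) :=
  if beta is b :: beta' then
    take (block_size alpha b) alpha :: blocks (drop (block_size alpha b) alpha) beta'
  else [::].

(* The sequence $\overline{K|I}$. *)
Definition block_lasts (n : nat) (K I : {set 'I_n.-1}) : seq nat :=
  [seq last 0%N a | a <- blocks (set_comp K) (set_comp I)].

Lemma blocks_uniq (bl : seq (seq nat)) :
  all (leq 1) (flatten bl) -> blocks (flatten bl) (map sumn bl) = bl.
Proof.
elim: bl => //= a bl IHbl; rewrite all_cat => /andP[pa pbl].
suff -> : block_size (a ++ flatten bl) (sumn a) = size a.
  by rewrite take_size_cat // drop_size_cat // IHbl.
rewrite /block_size; set P := (fun j => _); set s := iota _ _.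
have szs : (size a < size s)%N by rewrite size_iota size_cat; lia.
have nths j : (j <= size a)%N -> nth 0%N s j = j.
  by move=> lej; rewrite nth_iota ?add0n // size_cat; lia.
apply/eqP; rewrite eqn_leq; apply/andP; split.
  rewrite leqNgt; apply/negP => /(before_find 0%N).
  by rewrite nths // /P take_size_cat // eqxx.
rewrite leqNgt; apply/negP => lt_f.
have hasP : has P s by rewrite has_find; apply: ltn_trans szs.
have := nth_find 0%N hasP; set f := find P s in lt_f *.
rewrite nths 1?ltnW // /P takel_cat 1?ltnW // -{2}(cat_take_drop f a) sumn_cat.
rewrite -{1}[sumn _]addn0 eqn_add2l (drop_nth 0%N lt_f) /=.
by have /allP/(_ _ (mem_nth 0%N lt_f)) := pa; case: nth.
Qed.

Lemma pairmap_blocks (a : nat) (s t : seq nat) :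
  path ltn a t -> subseq s t -> last a s = last a t ->
  exists2 bl, flatten bl = pairmap (fun a b => b - a)%N a t &
    map sumn bl = pairmap (fun a b => b - a)%N a s.
Proof.
elim: t a s => [|y t IHt] a [|x s] //=; try by exists [::].
  move=> /andP[ltay pt] _ e; exfalso.
  have : (y <= last y t)%N.
    elim: (t) (y) pt => //= z u IHu w /andP[ltwz /IHu]; exact: (leq_trans (ltnW ltwz)).
  by rewrite -e leqNgt ltay.
move=> /andP[ltay pt]; case: eqP => [->|nxy] sst e.
  have [bl e1 e2] := IHt y s pt sst e.
  by exists ([:: (y - a)%N] :: bl); rewrite /= ?e1 ?e2 ?addn0.
have [bl e1 e2] := IHt y (x :: s) pt sst e.
have ltyx : (y < x)%N.
  move: pt; rewrite path_sortedE; last exact: ltn_trans.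
  by case/andP=> /allP h _; apply/h/(mem_subseq sst); rewrite mem_head.
case: bl e1 e2 => //= b bl e1 [e2 e3].
exists (((y - a)%N :: b) :: bl); rewrite /= ?e1 ?e2 ?e3 //.
by congr (_ :: _); lia.
Qed.

Lemma elts_path (n : nat) (I : {set 'I_n.-1}) :
  (0 < n)%N -> path ltn 0 (rcons (elts I) n).
Proof.
move=> n0; rewrite -[path _ _ _]/(sorted ltn (rcons (0%N :: elts I) n)).
rewrite sorted_pairwise; last exact: ltn_trans.
rewrite pairwise_rcons; apply/andP; split.
  rewrite /= n0; apply/allP=> _ /mapP[i _ ->].
  exact: ord_nxt_subproof.
rewrite pairwise_cons; apply/andP; split; first by apply/allP=> _ /mapP[i _ ->].
rewrite pairwise_map -sorted_pairwise; last by move=> i j l /=; apply: ltn_trans.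
rewrite {1}/enum_mem; apply: sorted_filter; first by move=> i j l /=; apply: ltn_trans.
have := iota_ltn_sorted 0 n.-1; rewrite -val_enum_ord sorted_map.
by rewrite enumT.
Qed.

Lemma elts_subseq (n : nat) (I K : {set 'I_n.-1}) :
  I \subset K -> subseq (elts I) (elts K).
Proof.
move=> sIK; apply: map_subseq.
suff -> : enum I = [seq x <- enum K | x \in I] by apply: filter_subseq.
rewrite /enum_mem -filter_predI; apply: eq_filter => i /=.
by case: (boolP (i \in I)) => // /(subsetP sIK) ->.
Qed.

Lemma size_set_comp (n : nat) (I : {set 'I_n.-1}) : size (set_comp I) = #|I|.+1.
Proof. by rewrite size_pairmap size_rcons size_map -cardE. Qed.

Lemma set_comp_gt0 (n : nat) (I : {set 'I_n.-1}) :
  (0 < n)%N -> all (leq 1) (set_comp I).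
Proof.
have gen s : forall a, path ltn a s ->
    all (leq 1) (pairmap (fun a b => b - a)%N a s).
  elim: s => //= x s IHs a /andP[ltax /IHs ->].
  by rewrite andbT subn_gt0.
by move/(elts_path I)/gen.
Qed.

Lemma blocksP (n : nat) (I K : {set 'I_n.-1}) (bl : seq (seq nat)) :
  (0 < n)%N -> I \subset K ->
  (flatten bl = set_comp K /\ map sumn bl = set_comp I) <->
  bl = blocks (set_comp K) (set_comp I).
Proof.
move=> n0 sIK.
have uq b : flatten b = set_comp K -> map sumn b = set_comp I ->
    b = blocks (set_comp K) (set_comp I).
  by move=> e1 e2; rewrite -e1 -e2 blocks_uniq // e1 set_comp_gt0.
split=> [[]|->]; first exact: uq.
have [|||b e1 e2] := @pairmap_blocks 0%N (rcons (elts I) n) (rcons (elts K) n).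
- exact: elts_path.
- by rewrite -!cats1 cat_subseq ?elts_subseq.
- by rewrite !last_rcons.
by rewrite -(uq b e1 e2).
Qed.

Lemma size_block_lasts (n : nat) (I K : {set 'I_n.-1}) :
  size (block_lasts K I) = #|I|.+1.
Proof.
rewrite size_map -(size_set_comp I); elim: (set_comp I) (set_comp K) => //= b s IHs a.
by rewrite IHs.
Qed.

(* Main.v *)
(* The permutations whose first i letters decrease and whose other letters
   increase correspond to the i-sets S of letters placed first, and D_[k-1] is
   the alternating sum of these classes over i < k. A permutation tau occurs in
   (class i) B_I once for every i-set T of positions (T = tau^-1 S) such that,
   on every block of positions delimited by I, T comes first, tau decreases on
   T and increases off T. This is a condition on each pair of adjacent
   positions, so its indicator is the sum, over all K containing Des tau, of a
   product of local weights; hence the coefficient of B_K is a signed sum over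
   T of these products. For I contained in K the products vanish unless T is a
   union of blocks of K containing every block of K that is not the last one in
   its block of I. Such a T is the complement of the union of a subsequence U
   of the last blocks, so |T| = n - sum U, and |T| < k means sum U > n - k. *)
Require Import Defs.
From HB Require Import structures.
From mathcomp Require Import all_boot all_order all_algebra all_fingroup.
From mathcomp Require Import zify ring.
Import GRing.Theory.
Local Open Scope ring_scope.

Set Implicit Arguments.
Unset Strict Implicit.
Unset Printing Implicit Defensive.

(** * Permutations with V-shaped one-line notation *)

Lemma card_ord_lt n (x : 'I_n) : #|[set y : 'I_n | (y < x)%N]| = x.
Proof.
rewrite -sum1_card (eq_bigl (fun y : 'I_n => (y < x)%N)).
  by rewrite -(big_ord_widen n (fun=> 1%N)) ?sum1_card ?card_ord 1?ltnW.
by move=> y; rewrite inE.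
Qed.

Lemma card_perm_lt n (r : 'S_n) a : #|[set b | (r b < r a)%N]| = r a.
Proof.
rewrite -[RHS]card_ord_lt -(card_imset _ (@perm_inj _ r)); apply: eq_card => y.
apply/imsetP/idP => [[b] |]; rewrite inE; first by move=> ? ->; rewrite inE.
by move=> lty; exists (r^-1 y)%g; rewrite ?inE permKV.
Qed.

(* Sorting by vkey S puts S first, in decreasing order. *)
Definition vkey n (S : {set 'I_n}) (a : 'I_n) : nat :=
  if a \in S then (n.-1 - a)%N else (n + a)%N.

Lemma vkey_inj n (S : {set 'I_n}) : injective (vkey S).
Proof.
move=> a b; rewrite /vkey => e; apply/val_inj => /=.
have := ltn_ord a; have := ltn_ord b.
by move: e; case: (a \in S); case: (b \in S); lia.
Qed.

Definition vrank n (S : {set 'I_n}) (a : 'I_n) : nat :=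
  #|[set b | (vkey S b < vkey S a)%N]|.

Lemma vrank_ltn n (S : {set 'I_n}) a : (vrank S a < n)%N.
Proof.
rewrite -[X in (_ < X)%N]card_ord -cardsT; apply: proper_card.
by rewrite properT; apply/eqP=> /setP/(_ a); rewrite !inE ltnn.
Qed.

Lemma vrank_mono n (S : {set 'I_n}) a b :
  (vrank S a < vrank S b)%N = (vkey S a < vkey S b)%N.
Proof.
case: (ltnP (vkey S a) (vkey S b)) => [lt_ab|le_ba].
  apply: proper_card; apply/properP; split.
    by apply/subsetP=> l; rewrite !inE => /ltn_trans->.
  by exists a; rewrite !inE ?ltnn.
apply/negbTE; rewrite -leqNgt; apply: subset_leq_card.
by apply/subsetP=> l; rewrite !inE => /leq_trans->.
Qed.

Lemma vrank_inj n (S : {set 'I_n}) :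
  injective (fun a => Ordinal (vrank_ltn S a)).
Proof.
move=> a b /(congr1 val) /= e; apply: (vkey_inj (S := S)).
have := vrank_mono S a b; have := vrank_mono S b a; rewrite e ltnn.
by case: (ltngtP (vkey S a) (vkey S b)).
Qed.

(* vperm S maps a letter to its position: the word that starts with S in
   decreasing order is its inverse. *)
Definition vperm n (S : {set 'I_n}) : 'S_n := perm (@vrank_inj n S).

Lemma vperm_mono n (S : {set 'I_n}) a b :
  (vperm S a < vperm S b)%N = (vkey S a < vkey S b)%N.
Proof. by rewrite !permE /= vrank_mono. Qed.

Lemma vperm_mem n (S : {set 'I_n}) a : (vperm S a < #|S|)%N = (a \in S).
Proof.
rewrite permE /= /vrank; have lta := ltn_ord a.
case: (boolP (a \in S)) => aS.
  apply: proper_card; apply/properP.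
  split; last by exists a; rewrite ?inE ?ltnn.
  apply/subsetP=> b; rewrite inE /vkey aS; case: (b \in S) => //; lia.
apply/negbTE; rewrite -leqNgt; apply/subset_leq_card/subsetP=> b bS.
rewrite inE /vkey bS (negbTE aS); have := ltn_ord b; lia.
Qed.

(** Position [i] is left free: for [0 < i < n] the class is the union of the descent classes of
    [i-1] and [i]. *)
Definition vshape n (i : nat) (p : 'S_n) : bool :=
  (initset n i.-1 \subset Des p) && (Des p \subset initset n i).

Lemma vshapeP n i (p : 'S_n) :
  reflect (forall a : 'I_n.-1,
             ((a.+1 < i)%N -> (p (ord_nxt a) < p (ord_cur a))%N)
          /\ ((i <= a)%N -> (p (ord_cur a) < p (ord_nxt a))%N))
          (vshape i p).
Proof.
have neq (a : 'I_n.-1) : (p (ord_nxt a) : nat) <> p (ord_cur a).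
  by move=> /val_inj/perm_inj/(congr1 val) /=; lia.
apply: (iffP andP) => [[/subsetP s1 /subsetP s2] a|H].
  split=> ai; first by have := s1 a; rewrite !inE; apply; lia.
  by have := s2 a; rewrite !inE => h; have := neq a; lia.
split; apply/subsetP=> a; rewrite !inE; have [h1 h2] := H a.
  by move=> ?; apply: h1; lia.
by move=> h; rewrite ltnNge; apply/negP=> /h2; lia.
Qed.

Lemma vshape_vperm n (S : {set 'I_n}) : vshape #|S| (vperm S)^-1%g.
Proof.
apply/vshapeP=> i; set a := ((vperm S)^-1)%g (ord_nxt i).
set b := ((vperm S)^-1)%g (ord_cur i).
have ra : vperm S a = ord_nxt i by rewrite /a permKV.
have rb : vperm S b = ord_cur i by rewrite /b permKV.
have : (vkey S b < vkey S a)%N by rewrite -vperm_mono ra rb /=.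
have := vperm_mem S a; have := vperm_mem S b; rewrite ra rb /= /vkey.
have := ltn_ord a; have := ltn_ord b.
by case: (a \in S); case: (b \in S); lia.
Qed.

Lemma ord_homo_ltn n (f : 'I_n -> nat) :
  (forall i : 'I_n.-1, (f (ord_cur i) < f (ord_nxt i))%N) ->
  {homo f : a b / (a < b)%N >-> (a < b)%N}.
Proof.
move=> step a b; have [m] := ubnP (b - a); elim: m b => // m IHm b ltm ltab.
have bP : (b.-1 < n.-1)%N by have := ltn_ord b; lia.
have := step (Ordinal bP).
have -> : ord_nxt (Ordinal bP) = b by apply/val_inj => /=; lia.
case: (ltnP a b.-1) => [lt1|le1].
  by apply: ltn_trans; apply: IHm => //=; lia.
by congr (f _ < _)%N; apply/val_inj => /=; lia.
Qed.

Lemma vperm_vshape n i (p : 'S_n) : (i <= n)%N -> vshape i p ->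
  let S := [set a | (p^-1 a < i)%N]%g in #|S| = i /\ vperm S = (p^-1)%g.
Proof.
move=> le_in /vshapeP vp S.
have SE q : (p q \in S) = (q < i)%N by rewrite inE permK.
(* Keys increase along the word of [p], so the position of a letter is its rank by key. *)
have keymono : {homo (fun q => vkey S (p q)) : a b / (a < b)%N >-> (a < b)%N}.
  apply: ord_homo_ltn => q; have [h1 h2] := vp q; rewrite /vkey !SE /=.
  have := ltn_ord (p (ord_cur q)); have := ltn_ord (p (ord_nxt q)).
  by case: (ltngtP q.+1 i); case: (ltnP q i); lia.
split.
  case: (ltngtP i n) le_in => // [lt_in|e_in] _; last first.
    rewrite -[RHS]card_ord -cardsT [in RHS]e_in; apply: eq_card => a.
    by rewrite !inE e_in ltn_ord.
  rewrite -[RHS]/(nat_of_ord (Ordinal lt_in)) -(permK p (Ordinal lt_in)).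
  by rewrite -card_perm_lt; apply: eq_card => a; rewrite !inE permK.
apply/permP=> a; apply/val_inj; rewrite permE /= -card_perm_lt.
apply: eq_card => b.
rewrite !inE -{1}(permKV p a) -{1}(permKV p b).
case: (ltngtP (p^-1 b)%g (p^-1 a)%g) => [/keymono-> //|/keymono h|/val_inj ->].
  by apply/negbTE; rewrite -leqNgt ltnW.
by rewrite ltnn.
Qed.

Lemma sum_vshape (R : comPzRingType) n i (h : 'S_n -> R) : (i <= n)%N ->
  \sum_(p : 'S_n | vshape i p) h p =
  \sum_(S : {set 'I_n} | #|S| == i) h (vperm S)^-1%g.
Proof.
move=> le_in.
rewrite (reindex_onto (fun S => (vperm S)^-1)%g
  (fun p => [set a | p^-1 a < i]%N)%g).
  apply: eq_bigl => S; rewrite invgK; apply/andP/eqP => [[vS /eqP eS]|<-].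
    by have [] := vperm_vshape le_in vS; rewrite invgK eS.
  split; first exact: vshape_vperm.
  by apply/eqP/setP => a; rewrite inE vperm_mem.
by move=> p /(vperm_vshape le_in)[_ ->]; rewrite invgK.
Qed.

(** Only [A] and [x |: A] lie between these two sets, and they differ. *)
Lemma eq_setU1_or (T : finType) (x : T) (A D : {set T}) : x \notin A ->
  ((D == x |: A) + (D == A) = (A \subset D) && (D \subset x |: A) :> nat)%N.
Proof.
move=> xA; rewrite !eqEsubset subUset sub1set; case: (boolP (x \in D)) => xD /=.
  have /negPf-> : ~~ (D \subset A) by apply: contra xA => /subsetP; apply.
  by rewrite addn0 andbC.
rewrite andbF add0n andbC; congr (nat_of_bool (_ && _)); apply/idP/idP => sD.
  exact: subset_trans sD (subsetUr _ _).
apply/subsetP=> y yD; have := subsetP sD y yD; rewrite !inE => /predU1P[e|//].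
by rewrite -e yD in xD.
Qed.

(** The sum telescopes, since consecutive V-shaped classes share one descent class. *)
Lemma Des_eq_initset (R : comPzRingType) n k (p : 'S_n) : (0 < k <= n)%N ->
  (Des p == initset n k.-1)%:R =
  \sum_(i < k) (-1) ^+ (k.-1 - i) * (vshape i p)%:R :> R.
Proof.
case: k => // k /=; elim: k => [|k IHk] ltkn.
  rewrite big_ord_recl big_ord0 addr0 subnn mul1r /vshape /=.
  by congr (nat_of_bool _)%:R; rewrite eqEsubset andbC.
rewrite big_ord_recr /= subnn mul1r.
under eq_bigr => i _ do rewrite subSn -1?ltnS // exprS -mulrA.
rewrite -mulr_sumr -IHk 1?ltnW // mulN1r.
apply/eqP; rewrite addrC eq_sym subr_eq -natrD; apply/eqP; congr (_ %:R).
have kP : (k < n.-1)%N by lia.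
have kN : Ordinal kP \notin initset n k by rewrite inE /= ltnn.
rewrite /vshape /=; have -> : initset n k.+1 = Ordinal kP |: initset n k.
  by apply/setP=> i; rewrite !inE -val_eqE /=; lia.
by rewrite eq_setU1_or.
Qed.

(** * Expansion in the basis B *)

(* j and iota say whether the boundary between two adjacent positions lies in
   Des tau and in I; b and b' say whether the two positions lie in T. *)
Definition edge_ok (j iota b b' : bool) : bool :=
  iota || (if b == b' then j == b else b).

(* The local weight of a boundary, kappa and iota telling whether it lies in K
   and in I; it is the solution of the equation edge_ok_wt. *)
Definition edge_wt (R : comPzRingType) (kappa iota b b' : bool) : R :=
  if kappa then (iota || b)%:R
  else if ~~ iota && (b == b') then (-1) ^+ b else 0.

Lemma edge_ok_wt (R : comPzRingType) j iota b b' :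
  (edge_ok j iota b b')%:R =
  edge_wt R true iota b b' + (if j then 0 else edge_wt R false iota b b').
Proof.
by case: j; case: iota; case: b; case: b'; rewrite /= ?addr0 ?add0r ?subrr.
Qed.

Definition compatible n (I D : {set 'I_n.-1}) (T : {set 'I_n}) : bool :=
  [forall i, edge_ok (i \in D) (i \in I) (ord_cur i \in T) (ord_nxt i \in T)].

Definition coefB (R : comPzRingType) n k (I K : {set 'I_n.-1}) : R :=
  \sum_(T : {set 'I_n} | (#|T| < k)%N) (-1) ^+ (k.-1 - #|T|) *
    \prod_i edge_wt R (i \in K) (i \in I) (ord_cur i \in T) (ord_nxt i \in T).

(** Choosing one of the two terms of [edge_ok_wt] at each boundary amounts to choosing [K]; a choice
    that omits a point of [D] contributes 0. *)
Lemma sum_superset_edge_wt (R : comPzRingType) n (I D : {set 'I_n.-1})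
    (T : {set 'I_n}) :
  \sum_(K : {set 'I_n.-1} | D \subset K)
     \prod_i edge_wt R (i \in K) (i \in I) (ord_cur i \in T) (ord_nxt i \in T) =
  (compatible I D T)%:R.
Proof.
transitivity (\prod_i (edge_ok (i \in D) (i \in I)
                        (ord_cur i \in T) (ord_nxt i \in T))%:R : R).
  under [RHS]eq_bigr => i _ do rewrite edge_ok_wt.
  rewrite (bigA_distr (R := R)) big_mkcond /=; apply: eq_big => // K _.
  case: ifP => [/subsetP sDK|/negbT/subsetPn[i iD iK]].
    apply: eq_bigr => i _; case: ifP => // iK.
    by case: ifP => // /sDK; rewrite iK.
  by rewrite (bigD1 i) //= (negbTE iK) iD mul0r.
rewrite /compatible; case: forallP => [H|/forallP].
  by apply: big1 => i _; rewrite H.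
by rewrite negb_forall => /existsP[i /negPf H]; rewrite (bigD1 i) //= H mul0r.
Qed.

Lemma Bsum_ffunE (R : comPzRingType) n (I : {set 'I_n.-1}) p :
  Bsum R I p = (Des p \subset I)%:R.
Proof.
rewrite BsumE sum_ffunE; under eq_bigr do rewrite DsumE.
case: (boolP (_ \subset _)) => sD.
  rewrite (bigD1 (Des p)) //= eqxx big1 ?addr0 // => J /andP[_ /negPf].
  by rewrite eq_sym => ->.
by apply: big1 => J sJ; case: eqP => // e; rewrite e sJ in sD.
Qed.

(** [vperm (tau @: T)] orders letters by key, and [tau i] lies in [tau @: T] exactly when [i] lies
    in [T]. *)
Lemma Des_vperm_subset n (I : {set 'I_n.-1}) (tau : 'S_n) (T : {set 'I_n}) :
  (Des (Defs.pcomp (vperm (tau @: T)) tau) \subset I) =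
  compatible I (Des tau) T.
Proof.
have E i : (i \notin Des (Defs.pcomp (vperm (tau @: T)) tau)) =
    edge_ok (i \in Des tau) false (ord_cur i \in T) (ord_nxt i \in T).
  rewrite !inE !pcompE vperm_mono /vkey !(mem_imset _ _ perm_inj) /edge_ok /=.
  have := ltn_ord (tau (ord_cur i)); have := ltn_ord (tau (ord_nxt i)).
  have : tau (ord_cur i) <> tau (ord_nxt i) :> nat.
    by move=> /val_inj/perm_inj/(congr1 val) /=; lia.
  by case: (_ \in T); case: (_ \in T) => /=; lia.
apply/subsetP/forallP => H i.
  rewrite /edge_ok; case: (boolP (i \in I)) => //= iI.
  by have := E i; rewrite /edge_ok /= => <-; apply: contra iI; apply: H.
by apply: contraLR => iI; rewrite E; have := H i; rewrite (negbTE iI).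
Qed.

Lemma galg_mulE (R : comPzRingType) n (f g : galg R n) tau :
  galg_mul f g tau = \sum_p f p * g (Defs.pcomp p^-1 tau)%g.
Proof.
rewrite ffunE; apply: eq_bigr => p _.
rewrite (big_pred1 (Defs.pcomp p^-1 tau)%g) // => s.
by rewrite /Defs.pcomp; apply/eqP/eqP => [<-|->]; rewrite ?mulgK ?mulgKV.
Qed.

Lemma mul_Dsum_BsumE (R : comPzRingType) n k (I : {set 'I_n.-1}) tau :
  (0 < k <= n)%N ->
  galg_mul (Dsum R (initset n k.-1)) (Bsum R I) tau =
  \sum_(T : {set 'I_n} | (#|T| < k)%N) (-1) ^+ (k.-1 - #|T|) *
    (compatible I (Des tau) T)%:R.
Proof.
move=> k_n; rewrite galg_mulE.
under eq_bigr => p _ do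
  rewrite DsumE (Des_eq_initset R p k_n) Bsum_ffunE mulr_suml.
rewrite exchange_big /=.
transitivity (\sum_(i < k) \sum_(S : {set 'I_n} | #|S| == i)
    (-1) ^+ (k.-1 - #|S|) * (Des (Defs.pcomp (vperm S) tau) \subset I)%:R : R).
  apply: eq_bigr => i _.
  have le_in : (i <= n)%N by have := ltn_ord i; lia.
  pose h p : R :=
    (-1) ^+ (k.-1 - i) * (Des (Defs.pcomp p^-1 tau)%g \subset I)%:R.
  transitivity (\sum_(p : 'S_n | vshape i p) h p).
    rewrite [RHS]big_mkcond; apply: eq_bigr => p _.
    by case: (vshape i p); rewrite ?mulr1 // mulr0 mul0r.
  rewrite sum_vshape //; apply: eq_bigr => S /eqP ->.
  by rewrite /h invgK.
rewrite (exchange_big_dep (fun S : {set 'I_n} => #|S| < k)%N) /=; last first.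
  by move=> i S _ /eqP ->.
(* Replace a set of letters by the set [T] of their positions in [tau], of the same size. *)
rewrite (reindex_inj (imset_inj (@perm_inj _ tau))) /=.
apply: eq_big => [T|T ltT]; first by rewrite card_imset //; apply: perm_inj.
rewrite card_imset in ltT *; last exact: perm_inj.
by rewrite (big_pred1 (Ordinal ltT)) ?Des_vperm_subset.
Qed.

Lemma mul_Dsum_Bsum_expand (R : comPzRingType) n k (I : {set 'I_n.-1}) :
  (0 < k <= n)%N ->
  galg_mul (Dsum R (initset n k.-1)) (Bsum R I) =
  \sum_K coefB R k I K *: Bsum R K.
Proof.
move=> k_n; apply/ffunP=> tau; rewrite mul_Dsum_BsumE // sum_ffunE.
under eq_bigr => T _ do rewrite -sum_superset_edge_wt mulr_sumr.
rewrite exchange_big /= [LHS]big_mkcond; apply: eq_bigr => K _.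
rewrite ffunE Bsum_ffunE; case: (Des tau \subset K); last by rewrite [RHS]mulr0.
by rewrite [RHS]mulr1.
Qed.

(** * Evaluation of the coefficients *)

Lemma sum_bool_tupleS (R : comPzRingType) m (G : seq bool -> R) :
  \sum_(t : m.+1.-tuple bool) G t =
  \sum_(t : m.-tuple bool) G (true :: t)
  + \sum_(t : m.-tuple bool) G (false :: t).
Proof.
rewrite (reindex (fun p : bool * m.-tuple bool => cons_tuple p.1 p.2)) /=.
  by rewrite -(pair_bigA _ (fun b (t : m.-tuple bool) => G (b :: t))) big_bool.
exists (fun t => (thead t, behead_tuple t)) => [[b t] _|t _].
  by congr pair; apply/val_inj.
by case/tupleP: t => b t; apply/val_inj.
Qed.

Lemma sum_bool_tuple0 (R : comPzRingType) (G : seq bool -> R) :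
  \sum_(t : 0.-tuple bool) G t = G [::].
Proof.
by rewrite (bigD1 [tuple]) //= big1 ?addr0 // => t /eqP[]; apply: tuple0.
Qed.

(** With [phi] the indicator of [x > n - k], this is the sum over U in the theorem. *)
Definition alt_sum (R : comPzRingType) (L : seq nat) (phi : nat -> R) : R :=
  \sum_(m : (size L).-tuple bool)
     (-1) ^+ size (mask m L) * phi (sumn (mask m L)).

Lemma alt_sum_nil (R : comPzRingType) (phi : nat -> R) :
  alt_sum [::] phi = phi 0%N.
Proof.
pose G m : R :=
  (-1) ^+ size (mask m ([::] : seq nat)) * phi (sumn (mask m [::])).
by rewrite /alt_sum (sum_bool_tuple0 G) /G /= mul1r.
Qed.

Lemma alt_sum_cons (R : comPzRingType) a L (phi : nat -> R) :
  alt_sum (a :: L) phi = alt_sum L phi - alt_sum L (fun x => phi (a + x)%N).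
Proof.
pose G m : R := (-1) ^+ size (mask m (a :: L)) * phi (sumn (mask m (a :: L))).
rewrite /alt_sum (sum_bool_tupleS _ G) /G addrC /= -sumrN.
congr (_ + _); apply: eq_bigr => m _.
by rewrite exprS mulN1r mulNr.
Qed.

(* b says whether a position lies in T, t does so for the positions after it,
   and l lists the boundaries in between with their membership in K and in I. *)
Fixpoint path_wt (R : comPzRingType) (b : bool) (l : seq (bool * bool))
    (t : seq bool) : R :=
  if l is p :: l' then if t is b' :: t' then
    edge_wt R p.1 p.2 b b' * path_wt R b' l' t' else 1 else 1.

(** The position described by [b] counts neither in the sign nor in the argument of [phi]. *)
Definition path_sum (R : comPzRingType) (b : bool) (l : seq (bool * bool))
    (phi : nat -> R) : R :=
  \sum_(t : (size l).-tuple bool)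
     (-1) ^+ count id t * path_wt R b l t * phi (count negb t).

Lemma path_sum_nil (R : comPzRingType) b (phi : nat -> R) :
  path_sum b [::] phi = phi 0%N.
Proof.
pose G t : R := (-1) ^+ count id t * path_wt R b [::] t * phi (count negb t).
by rewrite /path_sum (sum_bool_tuple0 G) /G /= !mul1r.
Qed.

Lemma path_sum_cons (R : comPzRingType) b p l (phi : nat -> R) :
  path_sum b (p :: l) phi =
  - (edge_wt R p.1 p.2 b true * path_sum true l phi)
  + edge_wt R p.1 p.2 b false * path_sum false l (fun x => phi x.+1).
Proof.
pose G t : R :=
  (-1) ^+ count id t * path_wt R b (p :: l) t * phi (count negb t).
rewrite /path_sum (sum_bool_tupleS _ G) /G /=.
rewrite !mulr_sumr -sumrN; congr (_ + _); apply: eq_bigr => t _.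
  by rewrite add0n exprS; ring.
by rewrite add0n add1n; ring.
Qed.

Lemma path_wtE (R : comPzRingType) b l t : size t = size l ->
  path_wt R b l t =
  \prod_(i < size l) edge_wt R
     (nth (false, false) l i).1 (nth (false, false) l i).2
     (nth false (b :: t) i) (nth false t i).
Proof.
elim: l b t => [|p l IHl] b [|b' t] //=; first by rewrite big_ord0.
by case=> e; rewrite big_ord_recl /= IHl.
Qed.

(* c is the length of the block of K read so far. *)
Fixpoint run_lasts (c : nat) (l : seq (bool * bool)) : seq nat :=
  if l is p :: l' then
    if p.1 then if p.2 then c :: run_lasts 1 l' else run_lasts 1 l'
    else run_lasts c.+1 l'
  else [:: c].

(* The left-hand side is the sum over all ways to put the current block of K, of
   length c, inside T or outside T: inside, its c positions and its c - 1
   boundaries contribute the sign (-1)^(2c-1). *)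
Lemma path_sum_run (R : comPzRingType) c l (phi : nat -> R) :
  all (fun p => p.2 ==> p.1) l ->
  - path_sum true l phi + path_sum false l (fun x => phi (c + x)%N) =
  - (-1) ^+ count fst l * alt_sum (run_lasts c l) phi.
Proof.
elim: l c phi => [|[kappa iota] l IHl] c phi /=.
  by rewrite !path_sum_nil alt_sum_cons !alt_sum_nil addn0 expr0 => _; ring.
case/andP; rewrite !path_sum_cons /edge_wt /=.
case: kappa; case: iota => //= _ al.
(* A boundary in I: the block of K that ends here may lie inside or outside T, which gives the two
   terms of [alt_sum_cons]. *)
- rewrite !mul1r alt_sum_cons (IHl 1%N phi al).
  rewrite (IHl 1%N (fun x => phi (c + x)%N) al).
  by rewrite exprS; ring.
(* A boundary in K but not in I: weight 0 forces the block that ends here into T, so its length is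
   not recorded. *)
- by rewrite !mul1r !mul0r (IHl 1%N phi al) exprS; ring.
(* A boundary outside K: the next position has the same status. Inside T its sign cancels the weight
   -1; outside T the run grows by one. *)
rewrite add0n -(IHl c.+1 phi al) !mul0r /= expr1 expr0 !mulN1r mul1r.
rewrite opprK addr0 oppr0 add0r.
by congr (_ + _); apply: eq_bigr => t _; rewrite addnS addSn.
Qed.

(** * Compositions and blocks read off boundary by boundary *)

Fixpoint run_comp (c : nat) (s : seq bool) : seq nat :=
  if s is b :: s' then
    if b then c :: run_comp 1 s' else run_comp c.+1 s'
  else [:: c].

(** [acc] holds the finished parts of the current block, and [c] is the length of the part being
    read. *)
Fixpoint run_blocks (acc : seq nat) (c : nat) (l : seq (bool * bool)) :=
  if l is p :: l' then
    if p.1 then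
      if p.2 then rcons acc c :: run_blocks [::] 1 l'
      else run_blocks (rcons acc c) 1 l'
    else run_blocks acc c.+1 l'
  else [:: rcons acc c].

Lemma flatten_run_blocks acc c l :
  flatten (run_blocks acc c l) = acc ++ run_comp c (unzip1 l).
Proof.
elim: l acc c => [|[[] []] l IHl] acc c /=; rewrite ?IHl ?cats0 ?cats1 //.
- by rewrite cat_rcons.
- by rewrite cat_rcons.
Qed.

Lemma sumn_run_blocks acc c l : all (fun p => p.2 ==> p.1) l ->
  map sumn (run_blocks acc c l) = run_comp (sumn acc + c) (unzip2 l).
Proof.
elim: l acc c => [|[[] []] l IHl] acc c //= al; rewrite ?IHl ?sumn_rcons //=.
- by rewrite addn1.
- by rewrite addnS.
Qed.

Lemma last_run_blocks acc c l :
  map (last 0%N) (run_blocks acc c l) = run_lasts c l.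
Proof.
by elim: l acc c => [|[[] []] l IHl] acc c /=; rewrite ?IHl ?last_rcons.
Qed.

(** Here [a] is the last element met, so the part being read has length [j.+1 - a] at boundary
    [j]. *)
Lemma pairmap_iota_run_comp (P : pred nat) a j m : (a <= j)%N ->
  pairmap (fun a b => b - a)%N a
    (rcons [seq i.+1 | i <- iota j m & P i] (j + m).+1) =
  run_comp (j.+1 - a) [seq P i | i <- iota j m].
Proof.
elim: m a j => [|m IHm] a j aj /=; first by rewrite addn0.
case: (P j) => /=; rewrite addnS -addSn IHm; try lia; first by rewrite subSnn.
by rewrite subSn //; lia.
Qed.

Lemma set_comp_run n (K : {set 'I_n}) :
  set_comp (n := n.+1) K = run_comp 1 [seq i \in K | i <- enum 'I_n].
Proof.
pose P x := x \in map val (enum K).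
have PE (i : 'I_n) : P i = (i \in K).
  by rewrite /P mem_map ?mem_enum //; apply: val_inj.
have := @pairmap_iota_run_comp P 0 0 n isT.
rewrite subn0 -val_enum_ord -map_comp.
rewrite (eq_map (PE : P \o val =1 _)) => <-; rewrite add0n /set_comp /elts.
congr (pairmap _ _ (rcons _ _)); rewrite filter_map -map_comp.
by rewrite enumT {1}/enum_mem; congr map; apply: eq_filter => i; rewrite /= PE.
Qed.

(** [run_blocks] flattens to comp(K) and its block sums form comp(I), so by uniqueness it is the
    block decomposition. *)
Lemma block_lasts_run n (I K : {set 'I_n}) : I \subset K ->
  block_lasts (n := n.+1) K I =
  run_lasts 1 [seq (i \in K, i \in I) | i <- enum 'I_n].
Proof.
move=> sIK; set l := map _ _; rewrite -(last_run_blocks [::]) /block_lasts.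
congr map; apply/esym/(@blocksP n.+1) => //; split.
  by rewrite flatten_run_blocks /= set_comp_run /l /unzip1 -map_comp.
rewrite sumn_run_blocks /= ?set_comp_run /l /unzip2 -?map_comp //.
by apply/allP=> _ /mapP[i _ ->]; apply/implyP/subsetP.
Qed.

Lemma coefBE (R : comPzRingType) n k (I K : {set 'I_n}) :
  (0 < k <= n.+1)%N -> I \subset K ->
  coefB R (n := n.+1) k I K =
  (-1) ^+ (k + #|K|) *
    alt_sum (block_lasts (n := n.+1) K I) (fun x => (n.+1 - k < x)%N%:R).
Proof.
move=> k_n sIK.
pose l := [seq (i \in K, i \in I) | i <- enum 'I_n].
have szl : size l = n by rewrite size_map size_enum_ord.
pose phi x : R := (n.+1 - k < x)%N%:R.
pose G (t : seq bool) : R := (-1) ^+ count id t *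
  path_wt R (head true t) l (behead t) * phi (count negb t).
(* The factor [(-1) ^+ k.-1] comes out of the sign, and [|T| < k] means that more than [n.+1 - k]
   positions lie outside T. *)
transitivity ((-1) ^+ k.-1 * \sum_(t : n.+1.-tuple bool) G t : R).
  rewrite /coefB mulr_sumr big_mkcond /=.
  rewrite (reindex (fun t : n.+1.-tuple bool => [set q | tnth t q])) /=;
    last first.
    exists (fun T : {set 'I_n.+1} => [tuple q \in T | q < n.+1]) => [t _|T _].
      by apply: eq_from_tnth => q; rewrite tnth_mktuple inE.
    by apply/setP=> q; rewrite inE tnth_mktuple.
  apply: eq_bigr => t _.
  have cardT : #|[set q | tnth t q]| = count id t.
    rewrite -sum1_card -sum1_count big_tuple.
    by apply: eq_bigl => q; rewrite inE.
  have cardN : (count negb t = n.+1 - count id t)%N.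
    have := count_predC id t.
    by rewrite size_tuple (@eq_count _ (predC id) negb) //; lia.
  rewrite cardT /G /phi cardN; case: ifP => ltT; last first.
    have -> : (n.+1 - k < n.+1 - count id t)%N = false by lia.
    by rewrite !mulr0.
  have -> : (n.+1 - k < n.+1 - count id t)%N by lia.
  rewrite mulr1 mulrA -exprD; congr (_ * _).
    rewrite -signr_odd -[RHS]signr_odd; congr (_ ^+ nat_of_bool _).
    by rewrite oddD oddB; [|lia].
  case/tupleP: t {cardT cardN ltT} => b t /=.
  rewrite path_wtE; last by rewrite size_tuple szl.
  rewrite -(big_mkord xpredT (fun i => edge_wt R
    (nth (false, false) l i).1 (nth (false, false) l i).2
    (nth false (b :: t) i) (nth false t i))) szl big_mkord.
  apply: eq_bigr => i _.
  have -> : nth (false, false) l i = (i \in K, i \in I).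
    by rewrite (nth_map i) ?size_enum_ord // nth_ord_enum.
  by rewrite !inE !(tnth_nth false).
(* Splitting on the first position gives the left-hand side of [path_sum_run] with a run of length
   1. *)
rewrite (sum_bool_tupleS _ G) /G /=.
have := @path_sum_run R 1 l phi _; rewrite -block_lasts_run // => run.
have -> : (-1) ^+ (k + #|K|) = (-1) ^+ k.-1 * (- (-1) ^+ count fst l) :> R.
  have -> : count fst l = #|K|.
    rewrite count_map cardE [in LHS]enumT [in RHS]/enum_mem size_filter.
    exact: eq_count.
  by case/andP: k_n => /prednK <- _; rewrite addSn exprS exprD mulN1r mulrN.
rewrite -[RHS]mulrA; congr (_ * _); rewrite -run; last first.
  by apply/allP=> _ /mapP[i _ ->]; apply/implyP/subsetP.
rewrite /path_sum szl -sumrN; congr (_ + _); apply: eq_bigr => t _.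
by rewrite add0n exprS mulN1r !mulNr.
Qed.

Theorem theorem2p2 (R : comPzRingType) (n k : nat) (I K : {set 'I_n.-1})
    (k_gt0 : (0 < k)%N) (le_kn : (k <= n)%N) (sIK : I \subset K) :
  exists hf : in_descent_algebra
                (galg_mul (Dsum R (initset n k.-1)) (Bsum R I)),
    Bcoef hf K =
      (-1) ^+ (k + #|K|) *
      \sum_(m : (size (block_lasts K I)).-tuple bool
              | (n - k < sumn (mask m (block_lasts K I)))%N)
         (-1) ^+ size (mask m (block_lasts K I)).
Proof.
have k_n : (0 < k <= n)%N by rewrite k_gt0.
have fB := mul_Dsum_Bsum_expand R I k_n.
have hf : in_descent_algebra (galg_mul (Dsum R (initset n k.-1)) (Bsum R I)).
  exists [ffun J : {set 'I_n.-1} =>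
    \sum_(L : {set 'I_n.-1} | J \subset L) coefB R k I L].
  rewrite fB; under eq_bigr do rewrite BsumE scaler_sumr.
  rewrite (exchange_big_dep xpredT) //=.
  by apply: eq_bigr => J _; rewrite ffunE scaler_suml.
exists hf; rewrite (Bcoef_eq hf fB).
(* For a successor [n.+1], the boundaries ['I_n.+1.-1] are ['I_n], as [coefBE] expects. *)
case: n I K sIK {le_kn fB hf} k_n => [|n] I K sIK k_n; first by lia.
rewrite coefBE //; congr (_ * _); rewrite [RHS]big_mkcond.
apply: eq_bigr => m _.
by case: ifP => _; rewrite ?mulr1 ?mulr0.
Qed.
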